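(* (i) There is no positive number $M$ such that $$\|f(A_1,B)-f(A_2,B)\|\le M\|f\|_{L^\infty(\mathbb R^2)}\|A_1-A_2\|$$ for all bounded functions $f$ on $\mathbb R^2$ with Fourier transform supported in $[-2\pi,2\pi]^2$ and for all finite rank self-adjoint operators $A_1,A_2,B$. (ii) Let $p>2$. Then there is no positive number $M$ such that $$\|f(A_1,B)-f(A_2,B)\|_{\boldsymbol S_p}\le M\|f\|_{L^\infty(\mathbb R^2)}\|A_1-A_2\|_{\boldsymbol S_p}$$ for all bounded functions $f$ on $\mathbb R^2$ with Fourier transform supported in $[-2\pi,2\pi]^2$ and for all finite rank self-adjoint operators $A_1,A_2,B$.
   Context: $\|\cdot\|$ is the operator norm and $\boldsymbol S_p$ the Schatten--von Neumann class. The Fourier transform is $(\mathscr Ff)(t)=\int f(x)e^{-{\rm i}(x,t)}\,dx$, extended to tempered distributions; functions with compactly supported Fourier transform are identified with their continuous (smooth) representatives. For self-adjoint operators $A,B$, not assumed to commute, $f(A,B)=\iint f(x,y)\,dE_A(x)\,dE_B(y)$, where $E_A,E_B$ are the spectral measures; for finite rank $A,B$ this is the finite sum $f(A,B)=\sum_{\lambda\in\sigma(A),\,\mu\in\sigma(B)}f(\lambda,\mu)\,E_A(\{\lambda\})E_B(\{\mu\})$. *)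

(* Defs.v *)
From HB Require Import structures.
From mathcomp Require Import all_boot all_order all_algebra.
From mathcomp Require Import all_classical all_reals all_analysis.
From mathcomp Require Export sesquilinear complex.

Set Implicit Arguments.
Unset Strict Implicit.
Unset Printing Implicit Defensive.

Import Order.TTheory GRing.Theory Num.Theory.
Import numFieldNormedType.Exports.

Local Open Scope classical_set_scope.
Local Open Scope ring_scope.
Local Open Scope complex_scope.

Section Fourier.
Context {R : realType}.
Implicit Types (f psi : R * R -> R[i]) (T : (R * R -> R[i]) -> R[i]).

Local Notation lebesgue2 := (@lebesgue_measure R \x @lebesgue_measure R)%E.

Definition cintegral f : R[i] :=
  (\int[lebesgue2]_z complex.Re (f z)) +i* (\int[lebesgue2]_z complex.Im (f z)).

Definition cis (theta : R) : R[i] := cos theta +i* sin theta.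

Definition fourier psi : R * R -> R[i] :=
  fun t => cintegral (fun x => psi x * cis (- (x.1 * t.1 + x.2 * t.2))).

Fixpoint classC (k : nat) (g : R * R -> R) : Prop :=
  continuous g /\
  if k is k'.+1 then
    [/\ forall z, derivable g z (1, 0), forall z, derivable g z (0, 1),
        classC k' (derive g ^~ (1, 0)) & classC k' (derive g ^~ (0, 1))]
  else True.

Definition smooth psi : Prop :=
  forall k, classC k (fun z => complex.Re (psi z)) /\
            classC k (fun z => complex.Im (psi z)).

Definition fsupport psi : set (R * R) := closure [set z | psi z != 0].

Definition test_function psi : Prop := smooth psi /\ compact (fsupport psi).

(* A tempered distribution is represented by the functional
   psi |-> <T, psi>; a bounded function f acts by integration. *)
Definition regular_distribution f : (R * R -> R[i]) -> R[i] :=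
  fun psi => cintegral (fun z => f z * psi z).

Definition fourier_distribution T : (R * R -> R[i]) -> R[i] :=
  fun psi => T (fourier psi).

Definition distribution_support T : set (R * R) :=
  ~` \bigcup_(U in [set U : set (R * R) | open U /\
        forall psi, test_function psi -> fsupport psi `<=` U -> T psi = 0]) U.

(* Continuity of f selects the representative of the class in L^oo. *)
Definition band_limited f : Prop :=
  [/\ continuous (f : R * R -> R[i]^o),
      exists K : R, forall z, `|f z| <= K%:C &
      distribution_support (fourier_distribution (regular_distribution f))
        `<=` [set t | `|t.1| <= 2 * pi /\ `|t.2| <= 2 * pi]].

Definition Linfty_norm f : \bar R :=
  ('N[lebesgue2]_+oo [EFin \o (fun z => complex.Re `|f z|%R)])%E.

End Fourier.

Section Operators.
Context {R : realType} {H : completeNormedModType R[i]}.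
Variable dot : {dot H for Num.conj}.
Implicit Types (A B K : {linear H -> H}) (T : H -> H) (V : set H).

(* For a subspace V this says that the dimension of V is at most n. *)
Definition dim_le (n : nat) V : Prop :=
  exists v : 'I_n -> H, forall x, V x ->
    exists c : 'I_n -> R[i], x = \sum_(i < n) c i *: v i.

Definition rank_le (n : nat) T : Prop := dim_le n (range T).

Definition finite_rank_selfadjoint A : Prop :=
  [/\ continuous A, exists n, rank_le n A &
      forall x y, dot (A x) y = dot x (A y)].

(* The norm of H takes its values in R[i]; norms and s-numbers are taken in
   the extended reals, so that no boundedness has to be assumed. *)
Definition opnorm T : \bar R :=
  ereal_sup [set (complex.Re `|T x|)%:E | x in [set x : H | `|x| <= 1]].

(* Indexed from 0; for compact T these are the eigenvalues of (T^* T)^(1/2). *)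
Definition singular_number T (n : nat) : \bar R :=
  ereal_inf [set opnorm (T \- (K : H -> H)) | K in
    [set K : {linear H -> H} | continuous K /\ rank_le n K]].

Definition schatten_norm (p : R) T : \bar R :=
  ((\sum_(0 <= n <oo) singular_number T n `^ p) `^ p^-1)%E.

Definition spectrum A : set R[i] :=
  [set l | ~ exists S : {linear H -> H},
     [/\ continuous S, cancel (fun x => A x - l *: x) S &
         cancel S (fun x => A x - l *: x)]].

Definition orthogonal_projection V (x : H) : H :=
  xget 0 [set y | V y /\ forall z, V z -> dot (x - y) z = 0].

(* E_A({l}); it vanishes when l is not an eigenvalue. *)
Definition spectral_atom A (l : R) : H -> H :=
  orthogonal_projection [set x | A x = l%:C *: x].

(* f(A, B), for self-adjoint A, B of finite rank (their spectra are then
   finite and real, so that the finitely supported sums are genuine). *)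
Definition fun_calc (f : R * R -> R[i]) A B : H -> H := fun x =>
  \sum_(l \in [set l : R | spectrum A l%:C])
    \sum_(m \in [set m : R | spectrum B m%:C])
      f (l, m) *: spectral_atom A l (spectral_atom B m x).

End Operators.

Definition infinite_dimensional (R : realType)
    (H : completeNormedModType R[i]) : Prop :=
  forall n, ~ dim_le n [set: H].

(* Main.v *)
(* If A and B have simple spectra inside the integers, with eigenbases g and h,
   then in these bases f(A, B) has the entries f(lam_i, mu_k) <h_k, g_i>: double
   operator integrals are Schur multipliers of the unitary matrix <h_k, g_i>.
   Take for it a normalized N x N Hadamard matrix s / sqrt N and prescribe
   f = s_ik at well separated integer nodes and f = 0 at the other integers.
   Then f(A1, B) has all its entries equal to 1 / sqrt N, hence norm sqrt N,
   while for A2 = A1 + (the projection onto the span of g) f(A2, B) = 0; here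
   A1 - A2 has norm 1 and S_p norm N^(1/p), and f can be taken bounded by 4
   and band-limited, by interpolation with the kernel (sin(pi x) / (pi x))^2. *)
Require Import Defs.
From HB Require Import structures.
From mathcomp Require Import all_boot all_order all_algebra.
From mathcomp Require Import all_classical all_reals all_analysis.
From mathcomp Require Import sesquilinear complex.
From mathcomp Require Import measurable_realfun ess_sup_inf ring lra zify.

Set Implicit Arguments.
Unset Strict Implicit.
Unset Printing Implicit Defensive.

Import Order.TTheory GRing.Theory Num.Theory.
Import numFieldNormedType.Exports.

Local Open Scope classical_set_scope.
Local Open Scope ring_scope.
Local Open Scope complex_scope.

(** * The cardinal sine and the pointwise estimates of its square *)

Section Sinc.
Context {R : realType}.
Implicit Types x w u : R.

(** Three demands fix the eigenvalues. Finite rank operators on an infinite-dimensional space have a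
    large kernel, so the eigenvalue 0 always interferes: [f] has to vanish on both axes, and no node
    may be 0. The nodes are even, so that adding 1 leads to integers where [f] is 0. Their spacing
    grows with N, so that [f] can be bounded by counting: one nearby kernel contributes at most 1
    and the remote ones at most 1/N each. This gives 2 in each variable, hence 4. The support
    condition is distributional, but [f] is integrable: Fubini reduces it to the vanishing of the
    cosine integrals of [f] outside the square, and these factor into one-dimensional integrals. The
    threshold p = 2 arises as follows. A matrix with equal entries has rank one, so f(A1, B) has the
    same norm sqrt N in every S_p, and bounding its S_p norm below by the operator norm loses
    nothing. The perturbation is a projection of rank N, of S_p norm N^(1/p). The quotient N^(1/2 -
    1/p) is unbounded for p > 2. *)

Definition sinc x : R := if x == 0 then 1 else sin x / x.

Lemma sinc0 : sinc 0 = 1.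
Proof. by rewrite /sinc eqxx. Qed.

Lemma sincN x : sinc (- x) = sinc x.
Proof. by rewrite /sinc oppr_eq0 sinN invrN mulrNN. Qed.

Lemma mul_sinc x : x * sinc x = sin x.
Proof.
rewrite /sinc; case: eqP => [->|/eqP x0]; first by rewrite mul0r sin0.
by rewrite mulrCA divff// mulr1.
Qed.

Lemma continuous_sinc : continuous sinc.
Proof.
move=> x; have [->|x0] := eqVneq x 0; last first.
  apply: (@cvg_trans _ ((fun y : R => sin y / y) @ x)); last first.
    rewrite /sinc (negPf x0).
    exact: (cvgM (@continuous_sin R x) (cvgV x0 cvg_id)).
  apply: near_eq_cvg.
  have : \forall y \near x, y != 0 by exact: open_neq.
  by apply: filterS => y /negPf y0; rewrite /sinc y0.
apply/continuous_withinNx; rewrite sinc0.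
(* The limit of sin y / y at 0 is read as the derivative of [sin] there. *)
have dsin : (fun h : R => h^-1 *: (sin (h *: 1 + 0) - sin 0)) @ 0^' --> (1 : R).
  have d1 : 'D_1 sin (0 : R) = 1 by rewrite derive_val cos0.
  by rewrite -[X in _ --> X]d1; exact: derivable_sin.
apply: cvg_trans dsin; apply: near_eq_cvg.
apply: filterS (nbhs_dnbhs_neq (0 : R)) => y /negPf y0.
by rewrite /sinc y0 sin0 subr0 addr0 /GRing.scale/= mulr1 mulrC.
Qed.

Lemma norm_sin_le x : `|sin x| <= `|x|.
Proof.
wlog x0 : x / 0 <= x.
  move=> H; have [/H//|/ltW x0] := leP 0 x.
  by rewrite -normrN -sinN -(normrN x) H// oppr_ge0.
have csin : {within `[0, x], continuous (@sin R)}.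
  by apply: continuous_subspaceT; exact: continuous_sin.
have [c _] := MVT_segment x0 (fun y _ => is_derive_sin y) csin.
rewrite sin0 !subr0 => ->; rewrite normrM -[leRHS]mul1r.
by rewrite ler_wpM2r// cos_max.
Qed.

Lemma norm_sinc_le1 x : `|sinc x| <= 1.
Proof.
rewrite /sinc; case: eqP => [_|/eqP x0]; first by rewrite normr1.
by rewrite normrM normfV ler_pdivrMr ?normr_gt0// mul1r norm_sin_le.
Qed.

Lemma sqr_sinc_le1 x : sinc x ^+ 2 <= 1.
Proof. by rewrite -real_normK ?num_real// expr_le1 ?norm_sinc_le1. Qed.

(** Multiplied by 1 + x^2 the left side becomes sinc^2 + sin^2, a sum of two terms at most 1. The
    integrable majorant yields the integrability of sinc^2. *)
Lemma sqr_sinc_le x : sinc x ^+ 2 <= 2 * (oneDsqr x)^-1.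
Proof.
rewrite ler_pdivlMr ?oneDsqr_gt0// /oneDsqr mulrDr mulr1 -exprMn [_ * x]mulrC.
rewrite mul_sinc -[leRHS]/(1 + 1); apply: lerD; first exact: sqr_sinc_le1.
by rewrite -real_normK ?num_real// expr_le1 ?sin_max.
Qed.

(* Multiplied by x ^+ 2 this is a product-to-sum formula; the three terms on the
   right have integrals proportional to |w/2 + pi|, |w/2 - pi| and |w/2|. *)
Lemma cos_mul_sqr_sinc x w : sinc (pi * x) ^+ 2 * cos (w * x) * pi ^+ 2 =
  ((w / 2 + pi) ^+ 2 * sinc ((w / 2 + pi) * x) ^+ 2
   + (w / 2 - pi) ^+ 2 * sinc ((w / 2 - pi) * x) ^+ 2) / 2
  - (w / 2) ^+ 2 * sinc (w / 2 * x) ^+ 2.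
Proof.
move: pi => p; have [->|x0] := eqVneq x 0.
  by rewrite !mulr0 sinc0 cos0; field.
apply: (@mulfI _ (x ^+ 2)); first by rewrite sqrf_eq0.
have E a : x ^+ 2 * (a ^+ 2 * sinc (a * x) ^+ 2) = sin (a * x) ^+ 2.
  by rewrite mulrA -!exprMn [x * a]mulrC mul_sinc.
rewrite [in RHS]mulrBr [x ^+ 2 * (_ / 2)]mulrA [x ^+ 2 * (_ + _)]mulrDr !E.
have -> : x ^+ 2 * (sinc (p * x) ^+ 2 * cos (w * x) * p ^+ 2) =
  sin (p * x) ^+ 2 * cos (w * x) by rewrite -(E p); ring.
have -> : w * x = w / 2 * x + w / 2 * x by field.
rewrite !mulrDl mulNr sinB sinD cosD.
have := cos2Dsin2 (p * x).
move: (cos (w / 2 * x)) (sin (w / 2 * x)) (cos (p * x)) (sin (p * x)).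
move=> a b c d /eqP; rewrite -subr_eq0 => /eqP cd.
apply/eqP; rewrite -subr_eq0; apply/eqP.
(* The two sides differ by a multiple of cos^2 + sin^2 - 1 at [p * x]. *)
transitivity (- b ^+ 2 * (c ^+ 2 + d ^+ 2 - 1)); first by field.
by rewrite cd mulr0.
Qed.

End Sinc.

(** * Affine substitutions in integrals over the line *)

Section ChangeOfVariables.
Context {R : realType}.
Local Notation mu := (@lebesgue_measure R).
Implicit Types (G h : R -> R) (a b : R).

Lemma ge0_integral_affine G a b : 0 < a -> continuous G -> (forall x, 0 <= G x) ->
  (\int[mu]_x (G x)%:E = \int[mu]_x (G (a * x + b) * a)%:E)%E.
Proof.
move=> a0 cG G0; pose F x : R := a * x + b.
have dF (x : R) : is_derive x (1 : R) F a.
  have -> : F = a *: (@id R) + cst b by [].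
  by apply: is_derive_eq; rewrite addr0 /GRing.scale/= mulr1.
have F'E : F^`()%classic = cst a.
  by apply/funext => x; rewrite derive1E derive_val.
rewrite (@increasing_ge0_integration_by_substitutionT _ F)//.
- by apply: eq_integral => x _; rewrite F'E.
- by move=> x y xy; rewrite /F ltrD2r ltr_pM2l.
- by rewrite F'E; exact: cst_continuous.
- by rewrite F'E; exact: is_cvg_cst.
- by rewrite F'E; exact: is_cvg_cst.
- apply/cvgrNyPle => A.
  apply: filterS (nbhs_ninfty_le (num_real ((A - b) / a))) => x.
  by rewrite ler_pdivlMr// mulrC -lerBrDr.
- apply/cvgryPge => A.
  apply: filterS (nbhs_pinfty_ge (num_real ((A - b) / a))) => x.
  by rewrite ler_pdivrMr// mulrC -lerBlDr.
Qed.

Lemma ge0_integral_opp G : continuous G -> (forall x, 0 <= G x) ->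
  (\int[mu]_x (G x)%:E = \int[mu]_x (G (- x))%:E)%E.
Proof.
move=> cG G0; have cGN : continuous (G \o -%R).
  by move=> x; apply: continuous_comp; [exact: opp_continuous|exact: cG].
have mG (h : R -> R) : continuous h -> measurable_fun [set: R] (fun x => (h x)%:E).
  by move=> ch; apply/measurable_EFinP; exact: continuous_measurable_fun.
have split h : continuous h -> (forall x, 0 <= h x) ->
    (\int[mu]_x (h x)%:E =
     \int[mu]_(x in `]-oo, 0%R]) (h x)%:E + \int[mu]_(x in `[0%R, +oo[) (h x)%:E)%E.
  move=> ch h0; rewrite -{1}setC0 -(set_itvoc0 0%R) setCitv/= ge0_integral_setU//=.
  - by rewrite integral_itv_obnd_cbnd//; apply: measurable_funTS; exact: mG.
  - by apply: measurable_funTS; exact: mG.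
  - by move=> x _; rewrite lee_fin.
  - rewrite disj_set2E; apply/eqP; rewrite -subset0 => x []/= /[!in_itv]/=.
    by rewrite leNgt andbT => /negP.
rewrite split// [RHS](split (G \o -%R))//; last by move=> x /=.
have refl (k : R -> R) : continuous k -> (forall x, 0 <= k x) ->
    (\int[mu]_(x in `]-oo, 0%R]) (k x)%:E = \int[mu]_(x in `[0%R, +oo[) (k (- x))%:E)%E.
  move=> ck k0; have := @ge0_integration_by_substitutionNy _ k 0.
  by rewrite oppr0; apply; [exact: continuous_subspaceT|move=> x _; exact: k0].
rewrite [RHS]addeC !refl//; last by move=> x /=.
by congr (_ + _)%E; apply: eq_integral => x _ /=; rewrite opprK.
Qed.

(** The positive and negative parts of a continuous function are continuous and nonnegative, and the
    integral is by definition the difference of theirs; so the rule passes to all signs without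
    integrability. *)
Lemma integral_comp_ge0 (phi : R -> R) h :
  (forall G, continuous G -> (forall x, 0 <= G x) ->
     (\int[mu]_x (G x)%:E = \int[mu]_x (G (phi x))%:E)%E) ->
  continuous h -> (\int[mu]_x (h x)%:E = \int[mu]_x (h (phi x))%:E)%E.
Proof.
move=> H ch.
have cmax (k : R -> R) : continuous k -> continuous (k^\+)%R.
  move=> ck; rewrite (_ : (k^\+)%R = fun x => 2^-1 * (k x + `|k x|)).
    move=> x; apply: cvgM; first exact: cvg_cst.
    by apply: cvgD; [exact: ck|apply: cvg_norm; exact: ck].
  by apply/funext => x; rewrite /funrpos maxr_absE subr0 addr0 mulrC.
have Hmax (k : R -> R) : continuous k ->
    (\int[mu]_x (EFin \o k)^\+ x = \int[mu]_x (EFin \o (k \o phi))^\+ x)%E.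
  move=> ck; rewrite !funerpos H//; exact: cmax.
rewrite integralE [RHS]integralE -[fun x => (h x)%:E]/(EFin \o h).
rewrite -[fun x => (h (phi x))%:E]/(EFin \o (h \o phi)) Hmax//.
congr (_ - _)%E.
have cNh : continuous (\- h)%R by move=> x; apply: cvgN; exact: ch.
have := Hmax _ cNh; rewrite (_ : EFin \o (\- h)%R = (\- (EFin \o h))%E)//.
rewrite (_ : EFin \o ((\- h)%R \o phi) = (\- (EFin \o (h \o phi)))%E)//.
by rewrite !funeposN.
Qed.

Lemma integral_translate b h : continuous h ->
  (\int[mu]_x (h x)%:E = \int[mu]_x (h (x + b))%:E)%E.
Proof.
apply: (@integral_comp_ge0 (fun x => x + b)) => G cG G0.
rewrite (@ge0_integral_affine _ 1 b)//.
by apply: eq_integral => x _; rewrite mul1r mulr1.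
Qed.

Lemma integral_odd h : continuous h -> (forall x, h (- x) = - h x) ->
  mu.-integrable setT (EFin \o h) -> (\int[mu]_x (h x)%:E = 0)%E.
Proof.
move=> ch oddh ih.
have := @integral_comp_ge0 -%R h ge0_integral_opp ch.
have -> : (\int[mu]_x (h (- x))%:E = - \int[mu]_x (h x)%:E)%E.
  rewrite -integralN//; last exact: (integrable_add_def _ ih).
  by apply: eq_integral => x _; rewrite oddh EFinN.
have := integrable_fin_num measurableT ih.
rewrite /comp; case: (integral _ _ _) => // r _ [] /eqP.
by rewrite -subr_eq0 opprK -mulr2n mulrn_eq0/= => /eqP ->.
Qed.

End ChangeOfVariables.

(** * The Fejer kernel *)

Section Fejer.
Context {R : realType}.
Local Notation mu := (@lebesgue_measure R).
Implicit Types (a b c w x t : R).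

Lemma integrable_oneDsqrV : mu.-integrable setT (EFin \o (fun x => (oneDsqr x)^-1)).
Proof.
have V0 x : 0 <= (oneDsqr x)^-1 by rewrite invr_ge0 ltW// oneDsqr_gt0.
apply/integrableP; split.
  by apply/measurable_EFinP; apply: continuous_measurable_fun; exact: continuous_oneDsqrV.
under eq_integral do rewrite /= ger0_norm//.
rewrite ge0_symfun_integralT//; last 2 first.
- exact: continuous_oneDsqrV.
- by move=> x /=; rewrite /oneDsqr sqrrN.
rewrite (_ : [set x | 0 <= x] = `[0, +oo[%classic); last first.
  by apply/seteqP; split => x /=; rewrite in_itv/= andbT.
by rewrite integral0y_oneDsqr -EFinM ltry.
Qed.

Lemma continuous_sqr_sinc a : continuous (fun x => sinc (a * x) ^+ 2).
Proof.
move=> x; apply: (@continuous_comp _ _ _ (fun x => sinc (a * x)) (fun y => y ^+ 2)).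
  apply: (@continuous_comp _ _ _ (fun x => a * x) sinc).
    exact: mulrl_continuous.
  exact: continuous_sinc.
exact: exprn_continuous.
Qed.

Lemma integrable_sqr_sinc : mu.-integrable setT (EFin \o (fun x : R => sinc x ^+ 2)).
Proof.
apply: (le_integrable measurableT _ _
  (integrableZl measurableT 2 integrable_oneDsqrV)); last first.
  move=> x _ /=; rewrite lee_fin ger0_norm ?sqr_ge0// (le_trans (sqr_sinc_le x))//.
  exact: ler_norm.
apply/measurable_EFinP; apply: continuous_measurable_fun => x.
have := @continuous_sqr_sinc 1 x; rewrite /continuous_at mul1r.
by under eq_fun do rewrite mul1r.
Qed.

Local Notation J := (\int[mu]_x sinc x ^+ 2).

(** Substitute [|a| * x]; sinc is even. The value of [J] is never computed: it will only be
    multiplied by a combination of coefficients that cancels. *)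
Lemma integral_scaled_sqr_sinc a :
  (\int[mu]_x (a ^+ 2 * sinc (a * x) ^+ 2)%:E = (`|a| * J)%:E)%E.
Proof.
have [->|a0] := eqVneq a 0.
  under eq_integral do rewrite expr0n mul0r.
  by rewrite integral0 normr0 mul0r.
have JE : J%:E = (\int[mu]_x (sinc x ^+ 2)%:E)%E.
  by rewrite fineK//; exact: (integrable_fin_num measurableT integrable_sqr_sinc).
have csinc2 : continuous (fun x : R => sinc x ^+ 2).
  move=> x; have := @continuous_sqr_sinc 1 x; rewrite /continuous_at mul1r.
  by under eq_fun do rewrite mul1r.
have na0 : 0 < `|a| by rewrite normr_gt0.
rewrite EFinM JE (ge0_integral_affine 0 na0 csinc2 (fun x => sqr_ge0 _)).
rewrite -ge0_integralZl//.
- apply: eq_integral => x _; rewrite -EFinM addr0; congr EFin.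
  have -> : sinc (`|a| * x) ^+ 2 = sinc (a * x) ^+ 2.
    by case: (ger0P a) => // _; rewrite mulNr sincN.
  by rewrite [RHS]mulrCA -[`|a| * _]expr2 real_normK ?num_real// mulrC.
- apply/measurable_EFinP; apply: continuous_measurable_fun => x.
  apply: cvgM; last exact: cvg_cst.
  by under eq_fun do rewrite addr0; rewrite addr0; exact: continuous_sqr_sinc.
- by move=> x _; rewrite lee_fin mulr_ge0// sqr_ge0.
Qed.

Lemma integrable_scaled_sqr_sinc a :
  mu.-integrable setT (EFin \o (fun x => a ^+ 2 * sinc (a * x) ^+ 2)).
Proof.
apply/integrableP; split.
  apply/measurable_EFinP; apply: continuous_measurable_fun => x.
  by apply: cvgM; [exact: cvg_cst|exact: continuous_sqr_sinc].
under eq_integral do rewrite /= (ger0_norm (mulr_ge0 (sqr_ge0 _) (sqr_ge0 _))).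
by rewrite integral_scaled_sqr_sinc ltry.
Qed.

(** Its Fourier transform is, up to a factor, the triangle function on [-2 pi, 2 pi]; this matches
    the band allowed for [f]. *)
Definition fejer x : R := sinc (pi * x) ^+ 2.

Lemma continuous_fejer : continuous fejer.
Proof. exact: continuous_sqr_sinc. Qed.

Lemma continuous_fejer_shift a : continuous (fun x => fejer (x - a)).
Proof.
move=> x; apply: (@continuous_comp _ _ _ (fun x => x - a) fejer).
  by apply: cvgB; [exact: cvg_id|exact: cvg_cst].
exact: continuous_fejer.
Qed.

Lemma continuous_cos_affine w c : continuous (fun x => cos (w * x + c)).
Proof.
move=> x; apply: (@continuous_comp _ _ _ (fun x => w * x + c) cos); last exact: continuous_cos.
by apply: cvgD; [exact: mulrl_continuous|exact: cvg_cst].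
Qed.

Lemma fejer_ge0 x : 0 <= fejer x. Proof. exact: sqr_ge0. Qed.

Lemma fejer_le1 x : fejer x <= 1. Proof. exact: sqr_sinc_le1. Qed.

Lemma integrable_fejer_shift a :
  mu.-integrable setT (EFin \o (fun x => fejer (x - a))).
Proof.
have pi2 : (pi : R) ^+ 2 != 0 by rewrite sqrf_eq0 gt_eqF// pi_gt0.
apply/integrableP; split.
  apply/measurable_EFinP; apply: continuous_measurable_fun.
  exact: continuous_fejer_shift.
under eq_integral do rewrite /= (ger0_norm (fejer_ge0 _)).
rewrite -(integral_translate (- a) continuous_fejer).
have /integrableP[_] := integrableZl measurableT (pi ^- 2)
  (integrable_scaled_sqr_sinc pi).
move=> H; apply: le_lt_trans H; rewrite le_eqVlt; apply/orP; left; apply/eqP.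
apply: eq_integral => x _ /=.
by rewrite mulrA mulVf// mul1r ger0_norm ?fejer_ge0.
Qed.

Lemma integrable_fejer_cos a w c :
  mu.-integrable setT (EFin \o (fun x => fejer (x - a) * cos (w * x + c))).
Proof.
have cF : continuous (fun x : R => fejer (x - a) * cos (w * x + c)).
  by move=> x; apply: cvgM; [exact: continuous_fejer_shift|exact: continuous_cos_affine].
apply: (le_integrable measurableT _ _ (integrable_fejer_shift a)).
  by apply/measurable_EFinP; exact: continuous_measurable_fun.
move=> x _; rewrite /= lee_fin normrM -[leRHS]mulr1.
by rewrite ler_wpM2l// cos_max.
Qed.

(** By the product-to-sum formula the integral is a multiple of |w/2 + pi| + |w/2 - pi| - 2 |w/2|.
    Once |w/2| >= pi, both shifted terms have the sign of w and the sum cancels. *)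
Lemma integral_fejer_cos0 w : 2 * pi <= `|w| ->
  (\int[mu]_x (fejer x * cos (w * x))%:E = 0)%E.
Proof.
move=> wpi.
have pi2 : (pi : R) ^+ 2 != 0 by rewrite sqrf_eq0 gt_eqF// pi_gt0.
pose k a := EFin \o (fun x => a ^+ 2 * sinc (a * x) ^+ 2).
transitivity (\int[mu]_x ((pi ^- 2 / 2)%:E *
    (k (w / 2 + pi)%R x + k (w / 2 - pi)%R x - 2%:E * k (w / 2)%R x)))%E.
  apply: eq_integral => x _; rewrite /k /= -!EFinD -EFinM; congr EFin.
  have := cos_mul_sqr_sinc x w; rewrite /fejer => /(canRL (mulfK pi2)) ->.
  by move: (lt0r_neq0 (pi_gt0 R)); move: (pi : R) => p p0; field.
have ik a : mu.-integrable setT (k a) by exact: integrable_scaled_sqr_sinc.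
have i1 := integrableD measurableT (ik (w / 2 + pi)) (ik (w / 2 - pi)).
have i2 := integrableZl measurableT 2 (ik (w / 2)).
rewrite integralZl//; last exact: integrableB.
rewrite integralB// integralD// integralZl// !integral_scaled_sqr_sinc.
transitivity (((pi ^- 2 / 2) * (`|w / 2 + pi| * J + `|w / 2 - pi| * J
  - 2 * (`|w / 2| * J)))%:E); first by [].
congr EFin; rewrite mulrA -mulrDl -mulrBl.
have -> : `|w / 2 + pi| + `|w / 2 - pi| - 2 * `|w / 2| = 0; last by rewrite mul0r mulr0.
have := pi_gt0 R; move: wpi; move: (pi : R) => p.
case: (ger0P w) => w0 wp p0.
- rewrite (@ger0_norm _ (w / 2)) ?(@ger0_norm _ (w / 2 + p)) ?(@ger0_norm _ (w / 2 - p)); lra.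
- rewrite (@ltr0_norm _ (w / 2)) ?(@ler0_norm _ (w / 2 + p)) ?(@ler0_norm _ (w / 2 - p)); lra.
Qed.

(** Translating by [a] changes only the phase. The addition formula then leaves a cosine integral,
    which is known to vanish, and the integral of an odd function. *)
Lemma integral_fejer_cos a w c : 2 * pi <= `|w| ->
  (\int[mu]_x (fejer (x - a) * cos (w * x + c))%:E = 0)%E.
Proof.
move=> wpi.
have ch : continuous (fun x : R => fejer (x - a) * cos (w * x + c)).
  by move=> x; apply: cvgM; [exact: continuous_fejer_shift|exact: continuous_cos_affine].
rewrite (integral_translate a ch).
pose d := w * a + c.
transitivity (\int[mu]_x ((cos d)%:E * (fejer x * cos (w * x))%:E -
   (sin d)%:E * (fejer x * sin (w * x))%:E))%E.
  apply: eq_integral => x _; rewrite -!EFinM -EFinB; congr EFin.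
  by rewrite addrK mulrDr -addrA -/d cosD; ring.
have ic : mu.-integrable setT (EFin \o (fun x => fejer x * cos (w * x))).
  have := integrable_fejer_cos 0 w 0; apply: eq_integrable => // x _ /=.
  by rewrite subr0 addr0.
have is_ : mu.-integrable setT (EFin \o (fun x => fejer x * sin (w * x))).
  have := integrable_fejer_cos 0 w (- (pi / 2)); apply: eq_integrable => // x _ /=.
  by rewrite subr0 cosBpihalf.
rewrite integralB//; [|exact: integrableZl|exact: integrableZl].
rewrite integralZl// integralZl// integral_fejer_cos0// mule0 integral_odd//.
- by rewrite mule0 sube0.
- move=> x; apply: cvgM; first exact: continuous_fejer.
  by apply: continuous_comp; [exact: mulrl_continuous|exact: continuous_sin].
- by move=> x; rewrite /fejer !mulrN sincN sinN mulrN.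
Qed.

End Fejer.

(** * Band-limited functions on the plane *)

Section ContinuousMeasurable2.
Context {R : realType}.

(** The sigma-algebra of the product is generated by rectangles, so [U] is written as a countable
    union of boxes with rational centres and radii 1/(n+1). *)
Lemma open_measurable2 (U : set (R * R)) : open U -> measurable U.
Proof.
move=> oU.
pose box (p q : rat) (n : nat) : set (R * R) :=
  ball (ratr p : R) n.+1%:R^-1 `*` ball (ratr q : R) n.+1%:R^-1.
have mbox p q n : measurable (box p q n).
  by apply: measurableX; apply: open_measurable; exact: ball_open.
rewrite (_ : U = \bigcup_p \bigcup_q \bigcup_n
    (if `[< box p q n `<=` U >] then box p q n else set0)).
  apply: bigcupT_measurable_rat => p; apply: bigcupT_measurable_rat => q.
  by apply: bigcupT_measurable => n; case: ifP => // _; exact: measurable0.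
apply/seteqP; split => [z Uz|z [p _ [q _ [n _]]]]; last first.
  by case: ifPn => [/asboolP bU /bU|].
have /nbhs_ballP[e /= e0 zeU] : nbhs z U by exact: open_nbhs_nbhs.
(* Two points of a box of radius below e/2 are less than e apart, so a box that contains [z] lies in
   [U]. *)
have /ltr_add_invr[n] : 0 < e / 2 by rewrite divr_gt0.
rewrite add0r => ne.
have near_rat (x : R) : exists p : rat, ball (ratr p : R) n.+1%:R^-1 x.
  have [|y [xy [p _ py]]] := @dense_rat R (ball x n.+1%:R^-1) _ (ball_open _ _).
    by exists x; exact: ballxx.
  by exists p; rewrite py; apply: ball_sym.
have [p pz] := near_rat z.1; have [q qz] := near_rat z.2.
exists p => //; exists q => //; exists n => //.
case: ifPn => [_|/asboolPn[]]; first by split.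
have sub (r : rat) (x y : R) : ball (ratr r : R) n.+1%:R^-1 x ->
    ball (ratr r : R) n.+1%:R^-1 y -> ball x e y.
  move=> rx ry; apply: (@le_ball _ _ _ (n.+1%:R^-1 + n.+1%:R^-1)).
    by rewrite [leRHS]splitr; apply: lerD; exact: ltW.
  by apply: ball_triangle ry; exact: ball_sym.
by move=> w [pw qw]; apply: zeU; split; [exact: sub pz pw|exact: sub qz qw].
Qed.

Lemma continuous_measurable_fun2 (f : R * R -> R) :
  continuous f -> measurable_fun setT f.
Proof.
move=> /continuousP cf; apply: (measurability _ (RGenOpens.measurableE R)).
move=> _ [_ [a [b ->] <-]]; rewrite setTI; apply: open_measurable2.
exact/cf/interval_open.
Qed.

End ContinuousMeasurable2.

(* The canonical sigma-finite structure on a product measure is shadowed by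
   the one for subprobabilities, hence this named copy. *)
Definition lebesgue2 {R : realType} :=
  (@lebesgue_measure R \x @lebesgue_measure R)%E.

HB.instance Definition _ (R : realType) := Measure.on (@lebesgue2 R).

Lemma sigma_finite_lebesgue2 (R : realType) : sigma_finite setT (@lebesgue2 R).
Proof.
have /sigma_finiteP[F [TF ndF Foo]] := sigma_finiteT (@lebesgue_measure R).
exists (fun n => F n `*` F n).
  rewrite -setXTT TF; apply/seteqP; split=> [[x y] [/= [n _ Fnx] [k _ Fky]]|].
    exists (maxn n k) => //; split.
    - by move: x Fnx; exact/subsetPset/ndF/leq_maxl.
    - by move: y Fky; exact/subsetPset/ndF/leq_maxr.
  by move=> [x y] [n _ []/= ? ?]; split; exists n.
move=> k; have [? ?] := Foo k; split; first exact: measurableX.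
by rewrite /lebesgue2 product_measure1E// lte_mul_pinfty// ge0_fin_numE.
Qed.

HB.instance Definition _ (R : realType) :=
  Measure_isSigmaFinite.Build _ _ _ (@lebesgue2 R) (@sigma_finite_lebesgue2 R).

Lemma integrable_prod d1 d2 (T1 : measurableType d1) (T2 : measurableType d2)
    (R : realType) (m1 : {sigma_finite_measure set T1 -> \bar R})
    (m2 : {sigma_finite_measure set T2 -> \bar R}) (u : T1 -> R) (v : T2 -> R) :
  m1.-integrable setT (EFin \o u) -> m2.-integrable setT (EFin \o v) ->
  (m1 \x m2)%E.-integrable setT (EFin \o (fun z => u z.1 * v z.2)).
Proof.
move=> iu iv.
have mu : measurable_fun setT u by apply/measurable_EFinP; exact: measurable_int iu.
have mv : measurable_fun setT v by apply/measurable_EFinP; exact: measurable_int iv.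
apply/integrable12ltyP.
  by apply/measurable_EFinP; apply: measurable_funM; apply: measurableT_comp.
have mnv : measurable_fun setT (fun y => (`|v y|)%:E).
  by apply/measurable_EFinP; exact: measurableT_comp.
under eq_integral => x _.
  under eq_integral => y _ do rewrite /= normrM EFinM.
  rewrite ge0_integralZl//; over.
have /integrableP[_ iv'] := iv; have /integrableP[_ iu'] := iu.
have v0 : (0 <= \int[m2]_y (`|v y|)%:E)%E by apply: integral_ge0 => y _; rewrite lee_fin.
rewrite ge0_integralZr//.
  by rewrite lte_mul_pinfty//; [exact: integral_ge0|rewrite ge0_fin_numE//; exact: integral_ge0].
by apply/measurable_EFinP; exact: measurableT_comp.
Qed.

Section BandLimited.
Context {R : realType}.
Local Notation mu := (@lebesgue_measure R).
Local Notation mu2 := (@lebesgue2 R).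
Implicit Types (F : R * R -> R) (u v : R -> R).

Definition outside_square (x : R * R) : Prop := 2 * pi < `|x.1| \/ 2 * pi < `|x.2|.

(* Letting the phase c vary encodes the vanishing of both the real and the
   imaginary part of the Fourier transform of F at x. *)
Definition paley_wiener F : Prop :=
  [/\ continuous F, mu2.-integrable setT (EFin \o F) &
      forall x c, outside_square x ->
        (\int[mu2]_t (F t * cos (x.1 * t.1 + x.2 * t.2 + c))%:E = 0)%E].

Lemma integrable_mul_cos F x c : continuous F -> mu2.-integrable setT (EFin \o F) ->
  mu2.-integrable setT (EFin \o (fun t => F t * cos (x.1 * t.1 + x.2 * t.2 + c))).
Proof.
move=> cF iF; apply: (le_integrable measurableT _ _ iF).
  apply/measurable_EFinP; apply: continuous_measurable_fun2 => t.
  apply: cvgM; first exact: cF.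
  apply: (@continuous_comp _ _ _ (fun t : R * R => x.1 * t.1 + x.2 * t.2 + c) cos);
    last exact: continuous_cos.
  apply: cvgD; last exact: cvg_cst.
  by apply: cvgD; apply: cvgM; [exact: cvg_cst|exact: cvg_fst|exact: cvg_cst|exact: cvg_snd].
move=> t _; rewrite /= lee_fin normrM -[leRHS]mulr1.
by rewrite ler_wpM2l// cos_max.
Qed.

(** By Fubini it suffices that the integral over one variable vanishes: the one whose frequency
    exceeds 2 pi. The other variable only enters its phase, which is why the one-dimensional lemma
    allows any phase. *)
Lemma paley_wiener_fejer a b : paley_wiener (fun z => fejer (z.1 - a) * fejer (z.2 - b)).
Proof.
have cF : continuous (fun z : R * R => fejer (z.1 - a) * fejer (z.2 - b)).
  move=> z; apply: cvgM.
    apply: (@continuous_comp _ _ _ fst (fun y => fejer (y - a))); first exact: cvg_fst.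
    exact: continuous_fejer_shift.
  apply: (@continuous_comp _ _ _ snd (fun y => fejer (y - b))); first exact: cvg_snd.
  exact: continuous_fejer_shift.
have iF : mu2.-integrable setT (EFin \o (fun z : R * R => fejer (z.1 - a) * fejer (z.2 - b))).
  exact: integrable_prod (integrable_fejer_shift a) (integrable_fejer_shift b).
split => // x c; have iFc := integrable_mul_cos x c cF iF.
case=> /ltW xpi.
- rewrite -(integral21_prod_meas1 iFc) /fubini_G integral0_eq// => t2 _ /=.
  transitivity ((fejer (t2 - b))%:E *
      (\int[mu]_t1 (fejer (t1 - a) * cos (x.1 * t1 + (x.2 * t2 + c)))%:E))%E.
    rewrite -integralZl//; last exact: integrable_fejer_cos.
    by apply: eq_integral => t1 _; rewrite /= -EFinM addrA; congr EFin; ring.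
  by rewrite integral_fejer_cos// mule0.
- rewrite -(integral12_prod_meas1 iFc) /fubini_F integral0_eq// => t1 _ /=.
  transitivity ((fejer (t1 - a))%:E *
      (\int[mu]_t2 (fejer (t2 - b) * cos (x.2 * t2 + (x.1 * t1 + c)))%:E))%E.
    rewrite -integralZl//; last exact: integrable_fejer_cos.
    apply: eq_integral => t2 _; rewrite /= -EFinM [in RHS]mulrA; congr (EFin (_ * cos _)); ring.
  by rewrite integral_fejer_cos// mule0.
Qed.

Lemma paley_wiener0 : paley_wiener (fun=> 0).
Proof.
split; [exact: cst_continuous|exact: integrable0|move=> x c _].
by under eq_integral do rewrite mul0r; rewrite integral0.
Qed.

Lemma paley_wienerZD r F G : paley_wiener F -> paley_wiener G ->
  paley_wiener (fun z => r * F z + G z).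
Proof.
move=> [cF iF F0] [cG iG G0]; split.
- move=> z; apply: cvgD; last exact: cG.
  by apply: cvgM; [exact: cvg_cst|exact: cF].
- exact: (integrableD measurableT (integrableZl measurableT r iF) iG).
move=> x c xout.
have iFc := integrable_mul_cos x c cF iF; have iGc := integrable_mul_cos x c cG iG.
transitivity (\int[mu2]_t (r%:E * (F t * cos (x.1 * t.1 + x.2 * t.2 + c))%:E
   + (G t * cos (x.1 * t.1 + x.2 * t.2 + c))%:E))%E.
  by apply: eq_integral => t _; rewrite mulrDl EFinD -mulrA EFinM.
rewrite integralD//; last exact: integrableZl.
by rewrite integralZl// F0// G0// mule0 adde0.
Qed.

Lemma paley_wiener_sum (I : Type) (s : seq I) (a : I -> R) (F : I -> R * R -> R) :
  (forall i, paley_wiener (F i)) -> paley_wiener (fun z => \sum_(i <- s) a i * F i z).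
Proof.
move=> pF; elim: s => [|i s IH].
  by under eq_fun do rewrite big_nil; exact: paley_wiener0.
by under eq_fun do rewrite big_cons; exact: paley_wienerZD.
Qed.

(** The product [p * d] is continuous, hence bounded on [K]; so [p] is dominated by a multiple of
    the integrable function 1/d. *)
Lemma integrable_compact_support (p : R * R -> R) (K : set (R * R)) :
  continuous p -> compact K -> (forall z, p z != 0 -> K z) ->
  mu2.-integrable setT (EFin \o p).
Proof.
move=> cp cK pK.
pose d (z : R * R) := oneDsqr z.1 * oneDsqr z.2.
have d0 z : 0 < d z by rewrite mulr_gt0// oneDsqr_gt0.
have cpd : continuous (fun z => p z * d z).
  move=> z; apply: cvgM; first exact: cp.
  apply: cvgM.
    apply: (@continuous_comp _ _ _ fst (@oneDsqr R)); first exact: cvg_fst.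
    exact: continuous_oneDsqr.
  apply: (@continuous_comp _ _ _ snd (@oneDsqr R)); first exact: cvg_snd.
  exact: continuous_oneDsqr.
have [M [Mreal MK]] := compact_bounded (continuous_compact (continuous_subspaceT cpd) cK).
have iV := integrable_prod (@integrable_oneDsqrV R) (@integrable_oneDsqrV R).
(* Boundedness of the image provides a bound by every number strictly above [M]; [|M| + 1] is one
   that is also nonnegative. *)
apply: (le_integrable measurableT _ _ (integrableZl measurableT (`|M| + 1) iV)).
  by apply/measurable_EFinP; exact: continuous_measurable_fun2.
move=> z _; rewrite /= lee_fin; apply: le_trans (ler_norm _).
rewrite -invfM ler_pdivlMr//.
have [->|pz0] := eqVneq (p z) 0.
  by rewrite normr0 mul0r ler_wpDl.
rewrite -[X in _ * X](gtr0_norm (d0 z)) -normrM; apply: MK.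
  by rewrite (le_lt_trans (ler_norm _))// ltrDl.
by exists z => //; exact: pK.
Qed.

(** The inner integral is the real part of the Fourier transform of p + iq; the pair (q, -p) gives
    the imaginary part. After Fubini, with majorant |F| (|p| + |q|), the integral over t for fixed x
    combines cosine integrals of [F] with phases 0 and -pi/2, which vanish outside the square. *)
Lemma integral_paley_wiener_fourier F (p q : R * R -> R) :
  paley_wiener F -> continuous p -> continuous q ->
  mu2.-integrable setT (EFin \o p) -> mu2.-integrable setT (EFin \o q) ->
  (forall x, p x != 0 \/ q x != 0 -> outside_square x) ->
  (\int[mu2]_t (F t * \int[mu2]_x
     (p x * cos (x.1 * t.1 + x.2 * t.2) + q x * sin (x.1 * t.1 + x.2 * t.2)))%:E = 0)%E.
Proof.
move=> [cF iF F0] cp cq ip iq out.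
pose G (z : (R * R) * (R * R)) : R := F z.1 *
  (p z.2 * cos (z.2.1 * z.1.1 + z.2.2 * z.1.2) +
   q z.2 * sin (z.2.1 * z.1.1 + z.2.2 * z.1.2)).
pose N x := `|p x| + `|q x|.
have iN : mu2.-integrable setT (EFin \o N).
  exact: (integrableD measurableT (integrable_norm ip) (integrable_norm iq)).
have mdot : measurable_fun setT (fun z : (R * R) * (R * R) => z.2.1 * z.1.1 + z.2.2 * z.1.2).
  by apply: measurable_funD; apply: measurable_funM; apply: measurableT_comp.
have mG : measurable_fun setT (EFin \o G).
  apply/measurable_EFinP; apply: measurable_funM.
    by apply: measurableT_comp => //; exact: continuous_measurable_fun2.
  apply: measurable_funD; apply: measurable_funM.
  - by apply: measurableT_comp => //; exact: continuous_measurable_fun2.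
  - apply: measurableT_comp mdot; apply: continuous_measurable_fun; exact: continuous_cos.
  - by apply: measurableT_comp => //; exact: continuous_measurable_fun2.
  - apply: measurableT_comp mdot; apply: continuous_measurable_fun; exact: continuous_sin.
have leN a b x : `|p x * cos a + q x * sin b| <= N x.
  apply: (le_trans (ler_normD _ _)); rewrite !normrM.
  by apply: lerD; rewrite -[leRHS]mulr1 ler_wpM2l// ?cos_max// sin_max.
have iG : (mu2 \x mu2)%E.-integrable setT (EFin \o G).
  apply: (le_integrable measurableT _ _ (integrable_prod iF iN)) => // z _.
  by rewrite /= lee_fin !normrM ler_wpM2l// (le_trans (leN _ _ _))// ler_norm.
transitivity (\int[mu2]_t \int[mu2]_x (EFin \o G) (t, x))%E.
  apply: eq_integral => t _; rewrite /G /=.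
  have ipq : mu2.-integrable setT (EFin \o (fun x =>
      p x * cos (x.1 * t.1 + x.2 * t.2) + q x * sin (x.1 * t.1 + x.2 * t.2))).
    apply: (le_integrable measurableT _ _ iN) => [|x _]; last first.
      by rewrite /= lee_fin (le_trans (leN _ _ _))// ler_norm.
    have mdt : measurable_fun setT (fun x : R * R => x.1 * t.1 + x.2 * t.2).
      by apply: measurable_funD; apply: measurable_funM => //; exact: measurable_cst.
    apply/measurable_EFinP; apply: measurable_funD; apply: measurable_funM.
    - exact: continuous_measurable_fun2.
    - apply: measurableT_comp mdt; apply: continuous_measurable_fun; exact: continuous_cos.
    - exact: continuous_measurable_fun2.
    - apply: measurableT_comp mdt; apply: continuous_measurable_fun; exact: continuous_sin.
  rewrite EFinM fineK; last exact: integrable_fin_num.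
  by rewrite -integralZl.
rewrite [LHS](integral12_prod_meas1 iG) -(integral21_prod_meas1 iG).
apply: integral0_eq => x _; rewrite /fubini_G /G /=.
(* Nothing locates x when p and q both vanish there, but then the integrand is 0. *)
have [pq0|] := boolP ((p x == 0) && (q x == 0)).
  case/andP: pq0 => /eqP-> /eqP->; apply: integral0_eq => t _.
  by rewrite !mul0r addr0 mulr0.
rewrite negb_and => /orP /out xout.
transitivity (\int[mu2]_t ((p x)%:E * (F t * cos (x.1 * t.1 + x.2 * t.2 + 0))%:E +
  (q x)%:E * (F t * cos (x.1 * t.1 + x.2 * t.2 + (- (pi / 2))))%:E))%E.
  apply: eq_integral => t _; rewrite cosBpihalf addr0 -!EFinM -EFinD; congr EFin; ring.
rewrite integralD//; last 2 first.
- by apply: integrableZl => //; exact: integrable_mul_cos.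
- by apply: integrableZl => //; exact: integrable_mul_cos.
rewrite integralZl//; last exact: integrable_mul_cos.
rewrite integralZl//; last exact: integrable_mul_cos.
by rewrite !F0// !mule0 adde0.
Qed.

Lemma open_outside_square : open outside_square.
Proof.
have cn : continuous (fun z : R * R => `|z.1|) /\ continuous (fun z : R * R => `|z.2|).
  by split=> z; apply: cvg_norm; [exact: cvg_fst|exact: cvg_snd].
rewrite (_ : outside_square = ((fun z : R * R => `|z.1|) @^-1` `]2 * pi, +oo[) `|`
    ((fun z : R * R => `|z.2|) @^-1` `]2 * pi, +oo[)).
  by apply: openU; apply: open_comp; do ?exact: interval_open;
    move=> z _; [exact: cn.1|exact: cn.2].
by apply/seteqP; split=> z /=; rewrite /outside_square !in_itv/= !andbT.
Qed.

Lemma norm_real_complex (r : R) : `|r%:C| = `|r|%:C.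
Proof. by rewrite normc_def/= expr0n addr0 sqrtr_sqr. Qed.

Lemma continuous_real_complex F : continuous F ->
  continuous ((fun z => (F z)%:C) : R * R -> R[i]^o).
Proof.
move=> cF z; apply/cvgrPdist_lt => e e0.
have [eI eR] : complex.Im e = 0 /\ 0 < complex.Re e.
  by move: e0; rewrite ltcE => /andP[/eqP].
have /cvgrPdist_lt/(_ _ eR) := cF z; apply: filterS => w.
rewrite -rmorphB norm_real_complex => h.
by rewrite ltcE/= eI eqxx.
Qed.

Lemma cis_mulN (z : R[i]) a : z * cis (- a) =
  (complex.Re z * cos a + complex.Im z * sin a) +i*
  (complex.Im z * cos a - complex.Re z * sin a).
Proof.
case: z => x y; rewrite /cis cosN sinN; apply/eqP.
by rewrite eq_complex/=; apply/andP; split; apply/eqP; ring.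
Qed.

(** One open set, [outside_square], excludes all points outside the square from the support: the
    pairing with any test function supported in it is 0. *)
Lemma band_limited_paley_wiener F (K : R) : paley_wiener F ->
  (forall z, `|F z| <= K) -> band_limited (fun z => (F z)%:C).
Proof.
move=> pF FK; have [cF iF _] := pF; split.
- exact: continuous_real_complex.
- by exists K => z; rewrite norm_real_complex lecR.
move=> t /= tS; apply: contrapT => tout; apply: tS.
exists outside_square; last first.
  have [t1|t1] := leP `|t.1| (2 * pi); last by left.
  have [t2|t2] := leP `|t.2| (2 * pi); last by right.
  by exfalso; apply: tout.
split; first exact: open_outside_square.
move=> psi [spsi cpsi] supp.
have [[cRe _] [cIm _]] := spsi 0%N.
pose p x := complex.Re (psi x); pose q x := complex.Im (psi x).
have psi0 x : p x != 0 \/ q x != 0 -> fsupport psi x.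
  move=> pq; apply: subset_closure => /=.
  by rewrite /p /q in pq *; apply/eqP => psi0; move: pq; rewrite psi0 /= eqxx; case.
have ip : mu2.-integrable setT (EFin \o p).
  by apply: integrable_compact_support cRe cpsi _ => x px; apply: psi0; left.
have iq : mu2.-integrable setT (EFin \o q).
  by apply: integrable_compact_support cIm cpsi _ => x qx; apply: psi0; right.
have cNp : continuous (fun x => - p x) by move=> x; apply: cvgN; exact: cRe.
have iNp : mu2.-integrable setT (EFin \o (fun x => - p x)).
  exact: (integrableN ip).
have out x : p x != 0 \/ q x != 0 -> outside_square x by move=> /psi0/supp.
have out' x : q x != 0 \/ - p x != 0 -> outside_square x.
  by rewrite oppr_eq0 => /or_comm; exact: out.
have ReE := integral_paley_wiener_fourier pF cRe cIm ip iq out.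
have ImE := integral_paley_wiener_fourier pF cIm cNp iq iNp out'.
have fourierE z : fourier psi z =
    (\int[mu2]_x (p x * cos (x.1 * z.1 + x.2 * z.2) + q x * sin (x.1 * z.1 + x.2 * z.2))) +i*
    (\int[mu2]_x (q x * cos (x.1 * z.1 + x.2 * z.2) + - p x * sin (x.1 * z.1 + x.2 * z.2))).
  rewrite /fourier /cintegral; congr Complex; apply: eq_Rintegral => x _.
    by rewrite cis_mulN.
  by rewrite cis_mulN/= mulNr.
rewrite /fourier_distribution /regular_distribution /cintegral.
rewrite -[RHS]/(0 +i* 0); congr Complex.
- transitivity (\int[mu2]_z (F z * \int[mu2]_x (p x * cos (x.1 * z.1 + x.2 * z.2) +
      q x * sin (x.1 * z.1 + x.2 * z.2)))); last by rewrite /Rintegral ReE.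
  by apply: eq_Rintegral => z _; rewrite fourierE /= mul0r subr0.
- transitivity (\int[mu2]_z (F z * \int[mu2]_x (q x * cos (x.1 * z.1 + x.2 * z.2) +
      - p x * sin (x.1 * z.1 + x.2 * z.2)))); last by rewrite /Rintegral ImE.
  by apply: eq_Rintegral => z _; rewrite fourierE /= mul0r addr0.
Qed.

End BandLimited.

(** * Band-limited interpolation of a bounded matrix at separated nodes *)

Section Symbol.
Context {R : realType} (N : nat).
Implicit Types (x y : R).

Lemma sin_natpi n : sin (pi * n%:R) = 0 :> R.
Proof.
elim: n => [|n IH]; first by rewrite mulr0 sin0.
by rewrite -natr1 mulrDr mulr1 sinDpi IH oppr0.
Qed.

Lemma fejer_nat m n : fejer (m%:R - n%:R : R) = (m == n)%:R.
Proof.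
wlog mn : m n / (n <= m)%N.
  move=> H; have [/H//|/ltnW nm] := leqP n m.
  by rewrite eq_sym -H// /fejer -opprB mulrN sincN.
rewrite -natrB// /fejer; have [->|nm] := eqVneq m n.
  by rewrite subnn mulr0 sinc0 expr1n.
apply/eqP; rewrite sqrf_eq0.
have pmn : pi * (m - n)%:R != 0 :> R.
  rewrite mulf_neq0 ?lt0r_neq0 ?pi_gt0// ltr0n subn_gt0.
  by rewrite ltn_neqAle eq_sym nm.
by rewrite /sinc (negPf pmn) sin_natpi mul0r.
Qed.

(** Positive multiples of 2N: they avoid 0, their successors are odd and hence not nodes, and no
    point is at distance less than N from two of them. *)
Definition node (i : 'I_N) : nat := (N.*2 * i.+1)%N.

Lemma node_inj : injective node.
Proof.
move=> i j /eqP; rewrite /node eqn_mul2l eqSS double_eq0 => /orP[/eqP N0|/eqP/val_inj//].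
by exfalso; have := leq_ltn_trans (leq0n i) (ltn_ord i); rewrite N0.
Qed.

Lemma node_neqS (i j : 'I_N) : (node i).+1 != node j.
Proof. by apply/eqP => /(congr1 odd); rewrite /node/= !oddM !odd_double. Qed.

Lemma node_neq0 (i : 'I_N) : 0%N != node i.
Proof.
rewrite eq_sym /node muln_eq0 negb_or double_eq0 andbT -lt0n.
exact: leq_ltn_trans (ltn_ord i).
Qed.

Lemma node_dist (i j : 'I_N) : i != j -> N.*2%:R <= `|(node i)%:R - (node j)%:R : R|.
Proof.
wlog ij : i j / (i < j)%N.
  move=> H; case: (ltngtP i j) => [/H//|ji|/val_inj-> /[!eqxx]//] neq.
  by rewrite distrC H// eq_sym.
move=> _; rewrite distrC ger0_norm ?subr_ge0 ?ler_nat ?leq_mul2l ?ltnS ?(ltnW ij) ?orbT//.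
rewrite -natrB ?leq_mul2l ?ltnS ?(ltnW ij) ?orbT// ler_nat /node -mulnBr subSS.
by rewrite leq_pmulr// subn_gt0.
Qed.

(** The decay 1/(pi x)^2 is weakened to 1/N, which is enough for a sum over N nodes. *)
Lemma fejer_le_far x : (0 < N)%N -> N%:R <= `|x| -> fejer x <= N%:R^-1.
Proof.
move=> N0 Nx.
have N1 : 1 <= N%:R :> R by rewrite ler1n.
have x0 : 0 < `|x| by rewrite (lt_le_trans _ Nx)// ltr0n.
have p0 : 1 <= (pi : R) by rewrite (le_trans _ (pi_ge2 _))// ler1n.
rewrite -[leRHS]mul1r ler_pdivlMr ?ltr0n//.
have : (pi * x) ^+ 2 * fejer x <= 1.
  rewrite /fejer -exprMn mul_sinc -real_normK ?num_real// expr_le1 ?sin_max//.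
apply: le_trans; rewrite mulrC ler_wpM2r ?fejer_ge0//.
rewrite -real_normK ?num_real// normrM (ger0_norm (le_trans ler01 p0)).
apply: (le_trans Nx); apply: (@le_trans _ _ (pi * `|x|)).
  by rewrite ler_peMl// ltW.
rewrite expr2 ler_peMl// ?mulr_ge0// ?(le_trans ler01 p0)//.
by rewrite mulr_ege1// (le_trans N1).
Qed.

(** At most one node is closer to x than N; it contributes at most 1, and so do all the others
    together. *)
Lemma sum_fejer_node_le x : (0 < N)%N -> \sum_(i < N) fejer (x - (node i)%:R) <= 2.
Proof.
move=> N0.
have sumN (P : pred 'I_N) : \sum_(i < N | P i) (N%:R^-1 : R) <= 1.
  rewrite sumr_const -[_ *+ _]mulr_natl ler_pdivrMr ?ltr0n// mul1r ler_nat.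
  by rewrite -[leqRHS]card_ord max_card.
have [i0 /= xi0|far] := pickP (fun i : 'I_N => `|x - (node i)%:R| < N%:R).
  rewrite (bigD1 i0)//= -[leRHS]/(1 + 1); apply: lerD; first exact: fejer_le1.
  apply: le_trans (sumN (fun i => i != i0)); apply: ler_sum => i ii0.
  apply: fejer_le_far => //.
  have := node_dist ii0; rewrite -addnn natrD => h.
  have := ler_distD x (node i)%:R (node i0)%:R.
  rewrite [`|_ - x|]distrC => h'; have := le_trans h h'; lra.
apply: (@le_trans _ _ 1); last by rewrite ler1n.
apply: le_trans (sumN predT); apply: ler_sum => i _.
by apply: fejer_le_far => //; rewrite leNgt far.
Qed.

Variable a : 'I_N -> 'I_N -> R.

Definition symbol (z : R * R) : R :=
  \sum_(ij : 'I_N * 'I_N) a ij.1 ij.2 *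
    (fejer (z.1 - (node ij.1)%:R) * fejer (z.2 - (node ij.2)%:R)).

(** With the coefficients bounded by 1, the double sum factors into two sums over nodes, each at
    most 2. *)
Lemma symbol_le z : (0 < N)%N -> (forall i j, `|a i j| <= 1) -> `|symbol z| <= 4.
Proof.
move=> N0 a1; apply: (le_trans (ler_norm_sum _ _ _)).
apply: (@le_trans _ _ (\sum_(ij : 'I_N * 'I_N)
    fejer (z.1 - (node ij.1)%:R) * fejer (z.2 - (node ij.2)%:R))).
  apply: ler_sum => ij _; rewrite normrM -[leRHS]mul1r.
  rewrite [`|fejer _ * _|]ger0_norm; last by rewrite mulr_ge0 ?fejer_ge0.
  by rewrite ler_wpM2r// mulr_ge0 ?fejer_ge0.
rewrite -(pair_bigA _ (fun i j => fejer (z.1 - (node i)%:R) * fejer (z.2 - (node j)%:R)))/=.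
under eq_bigr do rewrite -mulr_sumr.
rewrite -mulr_suml (_ : 4 = 2 * 2 :> R); last by rewrite -natrM.
by apply: ler_pM; rewrite ?sum_fejer_node_le// sumr_ge0// => i _; exact: fejer_ge0.
Qed.

Lemma band_limited_symbol : (0 < N)%N -> (forall i j, `|a i j| <= 1) ->
  band_limited (fun z => (symbol z)%:C).
Proof.
move=> N0 a1; apply: (@band_limited_paley_wiener _ _ 4) => [|z]; last exact: symbol_le.
exact: (paley_wiener_sum (index_enum _) (fun ij => a ij.1 ij.2)
  (fun ij => paley_wiener_fejer (node ij.1)%:R (node ij.2)%:R)).
Qed.

Lemma Linfty_norm_symbol_le : (0 < N)%N -> (forall i j, `|a i j| <= 1) ->
  (0 <= Linfty_norm (fun z => (symbol z)%:C) <= 4%:E)%E.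
Proof.
move=> N0 a1; rewrite /Linfty_norm Lnorm_ge0/= unlock /=.
case: ifPn => // _; apply/ess_supP; apply: aeW => z.
by rewrite /= expr0n addr0 sqrtr_sqr normr_id lee_fin symbol_le.
Qed.

Lemma symbol_node i j : symbol ((node i)%:R, (node j)%:R) = a i j.
Proof.
rewrite /symbol (bigD1 (i, j))//= !fejer_nat !eqxx !mulr1 big1 ?addr0// => -[k l] /= kl.
rewrite !fejer_nat !(inj_eq node_inj); move: kl.
rewrite xpair_eqE negb_and ![_ == k]eq_sym ![_ == l]eq_sym.
by case/orP=> /negPf ->; rewrite ?mul0r ?mulr0.
Qed.

(** The vanishing on a whole line serves twice: for m = 0 it silences the kernel, and for m one
    above a node it annihilates f(A2, B). *)
Lemma symbol_eq0l m y : (forall i, m != node i) -> symbol (m%:R, y) = 0.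
Proof.
by move=> H; rewrite /symbol big1// => ij _; rewrite /= fejer_nat (negPf (H _)) mul0r mulr0.
Qed.

Lemma symbol_eq0r m x : (forall i, m != node i) -> symbol (x, m%:R) = 0.
Proof.
by move=> H; rewrite /symbol big1// => ij _; rewrite /= fejer_nat (negPf (H _)) !mulr0.
Qed.

End Symbol.

(** * Diagonal operators and their functional calculus *)

Section Orthonormal.
Context {R : realType} {H : completeNormedModType R[i]}.
Variable dot : {dot H for Num.conj}.
Hypothesis dot_norm : forall x : H, dot x x = `|x| ^+ 2.
Implicit Types (x y z : H).

Lemma dotC x y : dot x y = (dot y x)^*%R.
Proof. by rewrite hermC expr0 mul1r. Qed.

Lemma dotDl x y z : dot (x + y) z = dot x z + dot y z.
Proof. exact: linearDl. Qed.

Lemma dotBl x y z : dot (x - y) z = dot x z - dot y z.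
Proof. exact: linearBl. Qed.

Lemma dotZl (a : R[i]) x y : dot (a *: x) y = a * dot x y.
Proof. exact: linearZl_LR. Qed.

Lemma dotZr (a : R[i]) x y : dot x (a *: y) = a^*%R * dot x y.
Proof. exact: linearZr_LR. Qed.

Lemma dot_suml (I : Type) (r : seq I) (E : I -> H) z :
  dot (\sum_(i <- r) E i) z = \sum_(i <- r) dot (E i) z.
Proof. exact: linear_sumlz. Qed.

Lemma dot_sumr (I : Type) (r : seq I) (E : I -> H) z :
  dot z (\sum_(i <- r) E i) = \sum_(i <- r) dot z (E i).
Proof. exact: linear_sumr. Qed.

Lemma conj_real (r : R) : (r%:C)^*%R = r%:C :> R[i].
Proof. by apply: conj_Creal; apply/complex_realP; exists r. Qed.

Definition orthonormal_family N (g : 'I_N -> H) : Prop :=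
  forall i j, dot (g i) (g j) = (i == j)%:R.

Section Family.
Variables (N : nat) (g : 'I_N -> H).
Hypothesis og : orthonormal_family g.

Lemma dot_sum_family (c : 'I_N -> R[i]) j : dot (\sum_i c i *: g i) (g j) = c j.
Proof.
rewrite dot_suml (bigD1 j)//= dotZl og eqxx mulr1 big1 ?addr0// => i ij.
by rewrite dotZl og (negPf ij) mulr0.
Qed.

Lemma norm_sum_family (c : 'I_N -> R[i]) :
  `|\sum_i c i *: g i| ^+ 2 = \sum_i `|c i| ^+ 2.
Proof.
rewrite -dot_norm dot_sumr; apply: eq_bigr => j _.
by rewrite dotZr dot_sum_family mulrC -normCK.
Qed.

Lemma bessel x : \sum_i `|dot x (g i)| ^+ 2 <= `|x| ^+ 2.
Proof.
set P := \sum_i dot x (g i) *: g i.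
have xP : dot (x - P) P = 0.
  rewrite /P dot_sumr big1// => j _.
  by rewrite dotZr dotBl dot_sum_family subrr mulr0.
rewrite -norm_sum_family -/P -[X in _ <= `|X| ^+ 2](subrK P) -[leRHS]dot_norm.
have -> : dot (x - P + P) (x - P + P) = dot (x - P) (x - P) + dot P P.
  exact: hnormDd.
by rewrite !dot_norm lerDr exprn_ge0.
Qed.

Lemma norm_dot_le x i : `|dot x (g i)| <= `|x|.
Proof.
rewrite -(ler_pXn2r (_ : (0 < 2)%N)) ?nnegrE//; apply: le_trans (bessel x).
by rewrite (bigD1 i)//= lerDl sumr_ge0// => j _; rewrite exprn_ge0.
Qed.

(** The family need not be complete: on its orthogonal complement the operator is 0, whence its
    finite rank and a possible further eigenvalue 0. *)
Definition diag_op (lam : 'I_N -> R) (x : H) : H :=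
  \sum_i ((lam i)%:C * dot x (g i)) *: g i.

Lemma diag_op_is_linear lam : linear (diag_op lam).
Proof.
move=> a x y; rewrite /diag_op scaler_sumr -big_split/=; apply: eq_bigr => i _.
by rewrite dotDl dotZl mulrDr scalerDl scalerA; congr (_ *: _ + _); ring.
Qed.

HB.instance Definition _ lam := GRing.isLinear.Build R[i] H H *:%R (diag_op lam)
  (diag_op_is_linear lam).

Lemma dot_diag_op lam x j : dot (diag_op lam x) (g j) = (lam j)%:C * dot x (g j).
Proof. exact: dot_sum_family. Qed.

Lemma diag_op_comp lam mu x : diag_op lam (diag_op mu x) = diag_op (fun i => lam i * mu i) x.
Proof. by apply: eq_bigr => i _; rewrite dot_diag_op mulrA -rmorphM. Qed.

Lemma continuous_diag_op lam : continuous (diag_op lam).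
Proof.
apply: bounded_linear_continuous; apply/bounded_funP => r.
exists ((\sum_i `|(lam i)%:C|) * r) => x xr.
rewrite /diag_op (le_trans (ler_norm_sum _ _ _))// mulr_suml; apply: ler_sum => i _.
rewrite normrZ normrM -mulrA ler_wpM2l//.
have -> : `|g i| = 1.
  by apply/eqP; rewrite -sqrp_eq1// -dot_norm og eqxx.
by rewrite mulr1 (le_trans (norm_dot_le _ _)).
Qed.

Lemma rank_le_diag_op lam : rank_le N (diag_op lam).
Proof. by exists g => _ [x _ <-]; exists (fun i => (lam i)%:C * dot x (g i)). Qed.

Lemma diag_op_selfadjoint lam : finite_rank_selfadjoint dot (diag_op lam).
Proof.
split; [exact: continuous_diag_op|by exists N; exact: rank_le_diag_op|move=> x y].
rewrite /diag_op dot_suml dot_sumr; apply: eq_bigr => i _.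
by rewrite dotZl dotZr rmorphM/= conj_real -dotC; ring.
Qed.

End Family.
End Orthonormal.

Section DiagonalCalculus.
Context {R : realType} {H : completeNormedModType R[i]}.
Variable dot : {dot H for Num.conj}.
Hypothesis dot_norm : forall x : H, dot x x = `|x| ^+ 2.
Variables (N : nat) (g : 'I_N -> H).
Hypothesis og : orthonormal_family dot g.
Implicit Types (lam : 'I_N -> R) (x y : H).

Lemma eq_diag_op lam mu x : lam =1 mu -> diag_op dot g lam x = diag_op dot g mu x.
Proof. by move=> e; apply: eq_bigr => i _; rewrite e. Qed.

Lemma diag_opB lam mu x :
  diag_op dot g lam x - diag_op dot g mu x = diag_op dot g (fun i => lam i - mu i) x.
Proof.
by rewrite -sumrB; apply: eq_bigr => i _; rewrite rmorphB mulrBl scalerBl.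
Qed.

Lemma diag_opD lam mu x :
  diag_op dot g lam x + diag_op dot g mu x = diag_op dot g (fun i => lam i + mu i) x.
Proof.
by rewrite -big_split; apply: eq_bigr => i _; rewrite /= rmorphD mulrDl scalerDl.
Qed.

Lemma diag_op_eq0 lam x : (forall i, lam i = 0) -> diag_op dot g lam x = 0.
Proof.
by move=> l0; apply: big1 => i _; rewrite l0 rmorph0 mul0r scale0r.
Qed.

Lemma scale_diag_op (a : R) lam x :
  a%:C *: diag_op dot g lam x = diag_op dot g (fun i => a * lam i) x.
Proof.
by rewrite scaler_sumr; apply: eq_bigr => i _; rewrite scalerA mulrA -rmorphM.
Qed.

(** The inverse of A - l is -1/l on the orthogonal complement of the family and 1/(lam_i - l) on
    g_i; the diagonal part corrects the former to the latter. *)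
Definition diag_resolvent lam (l : R) (x : H) : H :=
  (- l^-1)%:C *: x + diag_op dot g (fun i => (lam i - l)^-1 + l^-1) x.

Lemma diag_resolvent_is_linear lam l : linear (diag_resolvent lam l).
Proof.
move=> a x y; rewrite /diag_resolvent diag_op_is_linear !scalerDr !scalerA [a * _]mulrC.
by rewrite addrACA.
Qed.

HB.instance Definition _ lam l := GRing.isLinear.Build R[i] H H *:%R
  (diag_resolvent lam l) (diag_resolvent_is_linear lam l).

(** For any other l the operator [diag_resolvent] is a continuous two-sided inverse. Whether 0 is in
    the spectrum is left open; the functional calculus is evaluated for f vanishing on the axes. *)
Lemma spectrum_diag_op lam (l : R) :
  spectrum (diag_op dot g lam) l%:C -> l = 0 \/ exists i, l = lam i.
Proof.
move=> spec; apply: contrapT => /not_orP[/eqP l0 /forallNP lamN]; apply: spec.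
have ln i : lam i - l != 0 by rewrite subr_eq0 eq_sym; apply/eqP.
exists (diag_resolvent lam l); split.
- move=> x; apply: cvgD; first exact: scaler_continuous.
  exact: (continuous_diag_op dot_norm og).
- move=> x; rewrite linearB/= linearZ/= /diag_resolvent diag_op_comp//.
  rewrite !scalerDr scalerA -rmorphM mulrN mulfV// !scale_diag_op.
  rewrite diag_opD rmorphN1 scaleN1r opprD opprK addrCA diag_opB diag_op_eq0 ?addr0// => i.
  by have := ln i; move: l0 => l0' li0; field; rewrite l0' li0.
- move=> x; rewrite /diag_resolvent linearD/= linearZ/= diag_op_comp//.
  rewrite !scalerDr scalerA -rmorphM mulrN mulfV// !scale_diag_op.
  rewrite diag_opD rmorphN1 scaleN1r opprD opprK addrCA diag_opB diag_op_eq0 ?addr0// => i.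
  by have := ln i; move: l0 => l0' li0; field; rewrite l0' li0.
Qed.

Lemma diag_op_eigen lam i : diag_op dot g lam (g i) = (lam i)%:C *: g i.
Proof.
rewrite /diag_op (bigD1 i)//= og eqxx mulr1 big1 ?addr0// => j ji.
by rewrite og eq_sym (negPf ji) mulr0 scale0r.
Qed.

Lemma diag_op_spectrum lam i : spectrum (diag_op dot g lam) (lam i)%:C.
Proof.
case=> S [_ SK _]; have := SK (g i); rewrite /= diag_op_eigen subrr linear0 => g0.
by have := og i i; rewrite -g0 eqxx linear0l => /eqP; rewrite eq_sym oner_eq0.
Qed.

(** The eigenspace is the line through g_i: a nonzero eigenvalue puts its eigenvectors in the range,
    that is in the span of the family, and distinct eigenvalues kill all coefficients but the
    i-th. *)
Lemma spectral_atom_diag_op lam i x : injective lam -> lam i != 0 ->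
  spectral_atom dot (diag_op dot g lam) (lam i) x = dot x (g i) *: g i.
Proof.
move=> ilam li0.
have eig z : diag_op dot g lam z = (lam i)%:C *: z -> z = dot z (g i) *: g i.
  move=> Az.
  have z0 j : j != i -> dot z (g j) = 0.
    move=> ji; have := congr1 (dot^~ (g j)) Az.
    rewrite dot_diag_op// dotZl => /eqP; rewrite -subr_eq0 -mulrBl mulf_eq0.
    rewrite -rmorphB => /orP[|/eqP//].
    by rewrite eq_complex/= eqxx andbT subr_eq0 (inj_eq ilam) (negPf ji).
  have lC : (lam i)%:C != 0 by rewrite eq_complex/= eqxx andbT.
  apply: (scalerI lC); rewrite -Az /diag_op (bigD1 i)//= big1 ?addr0 ?scalerA// => j ji.
  by rewrite z0// mulr0 scale0r.
apply: xget_unique => /=.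
  split; first by rewrite linearZ/= diag_op_eigen !scalerA mulrC.
  move=> z /eig ->; rewrite dotBl dotZl !dotZr og eqxx mulr1.
  by rewrite mulrC subrr.
move=> y [/eig yE yP].
have := yP (g i) (diag_op_eigen lam i); rewrite dotBl => /eqP.
by rewrite subr_eq0 => /eqP ->.
Qed.

End DiagonalCalculus.

Lemma fsbig_injective {R : realType} {H : completeNormedModType R[i]} N
    (D : set R) (lam : 'I_N -> R) (F : R -> H) :
  injective lam -> (forall i, D (lam i)) ->
  (forall l, D l -> (forall i, l != lam i) -> F l = 0) ->
  \sum_(l \in D) F l = \sum_(i < N) F (lam i).
Proof.
move=> ilam Dlam F0.
rewrite (fsbigE [seq lam i | i <- enum 'I_N]).
- by rewrite big_map big_enum_cond/=; apply: eq_bigl => i; exact: mem_set.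
- by rewrite map_inj_uniq ?enum_uniq.
- by move=> l /= /mapP[i _ ->].
- move=> l Dl lN; apply: F0 => // i; apply: contra lN => /eqP ->.
  by rewrite map_f// mem_enum.
Qed.

(** Since f vanishes on both axes, the projections onto the kernels drop out. The remaining atoms
    have rank one, and the product of two of them produces the factor <h_k, g_i>. *)
Lemma fun_calc_diag_op {R : realType} {H : completeNormedModType R[i]}
    (dot : {dot H for Num.conj}) (dot_norm : forall x : H, dot x x = `|x| ^+ 2)
    N (g h : 'I_N -> H) (lam mu : 'I_N -> R) (f : R * R -> R[i]) x :
  orthonormal_family dot g -> orthonormal_family dot h ->
  injective lam -> injective mu ->
  (forall i, lam i != 0) -> (forall i, mu i != 0) ->
  (forall y, f (0, y) = 0) -> (forall y, f (y, 0) = 0) ->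
  fun_calc dot f (diag_op dot g lam) (diag_op dot h mu) x =
  \sum_i \sum_k (f (lam i, mu k) * (dot x (h k) * dot (h k) (g i))) *: g i.
Proof.
move=> og oh ilam imu lam0 mu0 f0l f0r; rewrite /fun_calc.
rewrite (fsbig_injective ilam) => [|i|l sl lN]; last 2 first.
- exact: diag_op_spectrum.
- case: (spectrum_diag_op dot_norm og sl) => [->|[i li]]; last first.
    by have := lN i; rewrite li eqxx.
  by apply: fsbig1 => m _; rewrite f0l scale0r.
apply: eq_bigr => i _.
rewrite (fsbig_injective imu) => [|k|m sm mN]; last 2 first.
- exact: diag_op_spectrum.
- case: (spectrum_diag_op dot_norm oh sm) => [->|[k mk]]; last first.
    by have := mN k; rewrite mk eqxx.
  by rewrite f0r scale0r.
apply: eq_bigr => k _.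
by rewrite !spectral_atom_diag_op// scalerA dotZl.
Qed.

(** * Orthonormal families and Hadamard matrices *)

Lemma exists_orthonormal_family {R : realType} {H : completeNormedModType R[i]}
    (dot : {dot H for Num.conj}) (dot_norm : forall x : H, dot x x = `|x| ^+ 2) :
  infinite_dimensional H -> forall N, exists g : 'I_N -> H, orthonormal_family dot g.
Proof.
move=> Hinf; elim=> [|N [g og]]; first by exists (fun=> 0) => -[].
(* A Gram-Schmidt step: N vectors do not span H, so some x lies outside their span; its component
   orthogonal to them is normalized and becomes the last member. *)
have [x xg] : exists x, forall c : 'I_N -> R[i], x <> \sum_(i < N) c i *: g i.
  apply: contrapT => /forallNP span; apply: (Hinf N); exists g => x _.
  by have /existsNP[c /contrapT] := span x; exists c.
pose y := x - \sum_i dot x (g i) *: g i.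
have y0 : y != 0 by rewrite subr_eq0; apply/eqP.
have yg j : dot y (g j) = 0 by rewrite dotBl dot_sum_family// subrr.
have gy j : dot (g j) y = 0 by rewrite dotC yg conjC0.
pose e := `|y|^-1 *: y.
have ee : dot e e = 1.
  rewrite dotZl dotZr dot_norm conj_Creal ?rpredV ?normr_real//.
  by rewrite mulrA -invfM -expr2 mulVf// expf_neq0 ?normr_eq0.
exists (fun i => if unlift ord_max i is Some j then g j else e) => i j.
case: unliftP => [i' ->|->]; case: unliftP => [j' ->|->].
- by rewrite og (inj_eq lift_inj).
- by rewrite dotZr gy mulr0 eq_sym (negPf (neq_lift _ _)).
- by rewrite dotZl yg mulr0 (negPf (neq_lift _ _)).
- by rewrite ee eqxx.
Qed.

(* The Walsh-Hadamard matrix (-1)^|A :&: B|, indexed by the subsets of 'I_n. *)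
Lemma exists_hadamard (R : realType) n : exists s : 'I_(2 ^ n) -> 'I_(2 ^ n) -> R,
  (forall i k, s i k ^+ 2 = 1) /\
  (forall k l, \sum_i s i k * s i l = (2 ^ n)%:R * (k == l)%:R).
Proof.
have cardN : #|{set 'I_n}| = (2 ^ n)%N.
  by rewrite -cardsT -powersetT card_powerset cardsT card_ord.
pose w (A B : {set 'I_n}) : R := \prod_x (if x \in A then (-1) ^+ (x \in B) else 1).
have ww A B C : w A B * w A C =
    \prod_x (if x \in A then (-1) ^+ (x \in B) * (-1) ^+ (x \in C) else 1).
  by rewrite -big_split/=; apply: eq_bigr => x _; case: ifP; rewrite ?mulr1.
have sgn2 (b : bool) : (-1 : R) ^+ b * (-1) ^+ b = 1 by rewrite -expr2 sqrr_sign.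
have w2 A B : w A B ^+ 2 = 1.
  by rewrite expr2 ww big1// => x _; case: ifP.
have worth B C : \sum_A w A B * w A C = (2 ^ n)%:R * (B == C)%:R.
  under eq_bigr do rewrite ww.
  (* Summing over all subsets A turns the sum of products into a product of factors 1 + (sign at x).
     Each factor is 2 if B and C agree at x, and 0 otherwise. *)
  rewrite -(bigA_distr 1 +%R (fun x => (-1) ^+ (x \in B) * (-1) ^+ (x \in C)) (fun=> 1)).
  have [->|BC] := eqVneq B C.
    under eq_bigr do rewrite sgn2.
    by rewrite prodr_const card_ord mulr1 natrX.
  have /existsP[x xBC] : [exists x, (x \in B) != (x \in C)].
    apply: contraR BC => /existsPn E.
    by apply/eqP/setP => x; apply/eqP; have := E x; rewrite negbK.
  rewrite mulr0 (bigD1 x)//=.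
  by case: (x \in B) (x \in C) xBC => -[]//= _; rewrite ?expr1 ?expr0 ?mulr1 ?mul1r addNr mul0r.
rewrite -cardN in worth *; exists (fun i k => w (enum_val i) (enum_val k)); split => // k l.
rewrite -(inj_eq enum_val_inj) -worth.
rewrite -(big_enum_val (fun A => w A (enum_val k) * w A (enum_val l)))/=.
by apply: eq_bigl.
Qed.

(** * Norms of operators *)

Section Norms.
Context {R : realType} {H : completeNormedModType R[i]}.
Implicit Types (T : H -> H) (K : {linear H -> H}) (x : H).

Lemma Re_norm_ge0 x : 0 <= complex.Re `|x|.
Proof. by have := normr_ge0 x; rewrite lecE => /andP[]. Qed.

Lemma opnorm_ge T x : `|x| <= 1 -> ((complex.Re `|T x|)%:E <= opnorm T)%E.
Proof. by move=> x1; apply: ereal_sup_ubound; exists x. Qed.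

Lemma opnorm_ge0 T : (0 <= opnorm T)%E.
Proof.
apply: le_trans (opnorm_ge T (_ : `|0| <= 1)); last by rewrite normr0 ler01.
by rewrite lee_fin Re_norm_ge0.
Qed.

Lemma opnorm_le T (c : R) : (forall x, `|x| <= 1 -> `|T x| <= c%:C) -> (opnorm T <= c%:E)%E.
Proof.
move=> Tc; apply: ge_ereal_sup => _ [x x1 <-]; rewrite lee_fin.
by have := Tc x x1; rewrite lecE => /andP[].
Qed.

Lemma singular_number_ge0 T n : (0 <= singular_number T n)%E.
Proof. by apply: le_ereal_inf_tmp => _ [K _ <-]; exact: opnorm_ge0. Qed.

Lemma singular_number_le T K n : continuous K -> rank_le n K ->
  (singular_number T n <= opnorm (T \- K)%R)%E.
Proof. by move=> cK rK; apply: ereal_inf_lbound; exists K. Qed.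

Lemma singular_number_le_opnorm T n : (singular_number T n <= opnorm T)%E.
Proof.
pose Z : {linear H -> H} := \0.
have -> : opnorm T = opnorm (T \- Z)%R.
  by congr opnorm; apply/funext => x /=; rewrite subr0.
apply: singular_number_le; first exact: cst_continuous.
exists (fun=> 0) => _ [x _ <-]; exists (fun=> 0).
by rewrite big1// => i _; rewrite scaler0.
Qed.

(** The singular number of index 0 is the operator norm, as only 0 has rank 0; it is one term of a
    nonnegative series. *)
Lemma opnorm_le_schatten_norm (p : R) T : 0 < p -> (opnorm T <= schatten_norm p T)%E.
Proof.
move=> p0; have s0 : singular_number T 0 = opnorm T.
  apply/eqP; rewrite eq_le singular_number_le_opnorm /=.
  apply: le_ereal_inf_tmp => _ [K [_ rK] <-].
  rewrite (_ : (T \- K)%R = T)//; apply/funext => x /=.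
  have [v rv] := rK; have [|c ->] := rv (K x); first by exists x.
  by rewrite big_ord0 subr0.
have -> : opnorm T = ((opnorm T `^ p) `^ p^-1)%E.
  by rewrite -poweRrM mulfV ?gt_eqF// poweRe1// opnorm_ge0.
apply: gt0_ler_poweR; rewrite ?invr_ge0 ?(ltW p0)// ?in_itv/= ?leey ?andbT ?poweR_ge0//.
  by apply: nneseries_ge0 => n _ _; exact: poweR_ge0.
rewrite -s0; have := @nneseries_lim_ge _ (fun n => singular_number T n `^ p)%E xpredT 0 1.
by rewrite big_nat1; apply => n _ _; exact: poweR_ge0.
Qed.

Lemma rank_le_widen T m n : (m <= n)%N -> rank_le m T -> rank_le n T.
Proof.
move=> mn [v rv].
pose w k := if insub k is Some j then v j else 0.
exists (fun i => w i) => x /rv[c ->].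
pose d k := if insub k is Some j then c j else 0.
exists (fun i => d i).
transitivity (\sum_(i < m) d i *: w i).
  by apply: eq_bigr => i _; rewrite /d /w valK.
rewrite (big_ord_widen n (fun k => d k *: w k))// big_mkcond/=.
by apply: eq_bigr => i _; case: ltnP => // mi; rewrite /w insubN -?leqNgt// scaler0.
Qed.

(** From index N on, [K] is its own approximant and the singular numbers vanish; the N earlier ones
    are at most 1. *)
Lemma schatten_norm_rank_le (p : R) K N : 0 < p -> continuous K -> rank_le N K ->
  (opnorm K <= 1)%E -> (schatten_norm p K <= (N%:R `^ p^-1)%:E)%E.
Proof.
move=> p0 cK rK K1.
have s0 n : (N <= n)%N -> singular_number K n = 0%E.
  move=> Nn; apply/eqP; rewrite eq_le singular_number_ge0 andbT.
  apply: (@le_trans _ _ (opnorm (K \- K)%R)); last first.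
    by apply: opnorm_le => x _ /=; rewrite subrr normr0.
  by apply: singular_number_le => //; exact: rank_le_widen rK.
have s1 n : (singular_number K n `^ p <= (n < N)%N%:R%:E)%E.
  case: ltnP => [_|/s0 ->]; last by rewrite poweR0r ?gt_eqF.
  rewrite -(@poweR1r _ p); apply: gt0_ler_poweR; rewrite ?(ltW p0)// ?in_itv/= ?leey ?andbT//.
    exact: singular_number_ge0.
  exact: le_trans (singular_number_le_opnorm _ _) K1.
rewrite -poweR_EFin; apply: gt0_ler_poweR; rewrite ?invr_ge0 ?(ltW p0)// ?in_itv/= ?leey ?andbT//.
- by apply: nneseries_ge0 => n _ _; exact: poweR_ge0.
apply: lime_le; first by apply: is_cvg_nneseries => n _ _; exact: poweR_ge0.
apply: nearW => m; apply: (@le_trans _ _ (\sum_(0 <= n < m) (n < N)%N%:R%:E)%E).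
  exact: lee_sum.
rewrite sumEFin lee_fin -natr_sum ler_nat.
suff -> : (\sum_(0 <= n < m) (n < N) = minn m N)%N by exact: geq_minr.
elim: m => [|m IH]; first by rewrite big_geq// min0n.
by rewrite big_nat_recr//= IH; case: ltnP => /=; lia.
Qed.

End Norms.

(** * The counterexample, common to both parts of the theorem *)

Section Counterexample.
Context {R : realType} {H : completeNormedModType R[i]}.
Variable dot : {dot H for Num.conj}.
Hypothesis dot_norm : forall x : H, dot x x = `|x| ^+ 2.

Lemma norm_sum_family_real N (g : 'I_N -> H) (c : 'I_N -> R) :
  orthonormal_family dot g ->
  `|\sum_i (c i)%:C *: g i| = (Num.sqrt (\sum_i c i ^+ 2))%:C.
Proof.
move=> og; apply/eqP; rewrite -(eqrXn2 (_ : (0 < 2)%N))//; last first.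
  by rewrite lecR sqrtr_ge0.
rewrite (norm_sum_family dot_norm og) -rmorphXn/= sqr_sqrtr; last first.
  by rewrite sumr_ge0// => i _; rewrite sqr_ge0.
apply/eqP; rewrite rmorph_sum/=; apply: eq_bigr => i _.
by rewrite norm_real_complex -rmorphXn/= real_normK// num_real.
Qed.

Lemma unbounded_double_operator_difference n : infinite_dimensional H ->
  exists (f : R * R -> R[i]) (A1 A2 B : {linear H -> H}),
  [/\ band_limited f, (0 <= Linfty_norm f <= 4%:E)%E,
      [/\ finite_rank_selfadjoint dot A1, finite_rank_selfadjoint dot A2
        & finite_rank_selfadjoint dot B],
      (opnorm ((A1 : H -> H) \- A2)%R <= 1)%E /\
      (forall p : R, 0 < p ->
        (schatten_norm p ((A1 : H -> H) \- A2)%R <= ((2 ^ n)%:R `^ p^-1)%:E)%E)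
    & ((Num.sqrt (2 ^ n)%:R)%:E <=
        opnorm (fun_calc dot f A1 B \- fun_calc dot f A2 B)%R)%E].
Proof.
move=> /(exists_orthonormal_family dot_norm) /(_ (2 ^ n)%N)[g og].
have [s [s2 sorth]] := exists_hadamard R n.
have N0 : (0 < 2 ^ n)%N by rewrite expn_gt0.
move: (2 ^ n)%N N0 g og s s2 sorth => N N0 g og s s2 sorth.
have s1 i k : `|s i k| <= 1 by rewrite -(expr_le1 (_ : 0 < 2)%N)// real_normK ?num_real// s2.
(* With this factor the sign matrix becomes orthogonal, so that [h] is a second orthonormal basis of
   the span of [g]. *)
pose r : R := (Num.sqrt N%:R)^-1.
have r2N : N%:R * r ^+ 2 = 1.
  by rewrite exprVn sqr_sqrtr// mulfV// pnatr_eq0 -lt0n.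
pose h k := \sum_i (r * s i k)%:C *: g i.
have hg k i : dot (h k) (g i) = (r * s i k)%:C by rewrite dot_sum_family.
have oh : orthonormal_family dot h.
  move=> k l; rewrite {2}/h dot_sumr.
  under eq_bigr do rewrite dotZr conj_real hg -rmorphM/=.
  rewrite -rmorph_sum/= (_ : \sum_i _ = (k == l)%:R) ?rmorph_nat//.
  transitivity (r ^+ 2 * \sum_i s i k * s i l).
    by rewrite mulr_sumr; apply: eq_bigr => i _; ring.
  by rewrite sorth mulrA [r ^+ 2 * _]mulrC r2N mul1r.
(* A1 and B have the nodes as eigenvalues; A2 has their successors, where the symbol vanishes. *)
pose lam1 (i : 'I_N) : R := (node i)%:R; pose lam2 (i : 'I_N) : R := (node i).+1%:R.
have inj1 : injective lam1 by move=> i j /eqP; rewrite eqr_nat => /eqP/node_inj.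
have inj2 : injective lam2 by move=> i j /eqP; rewrite eqr_nat eqSS => /eqP/node_inj.
have lam1N0 i : lam1 i != 0 by rewrite pnatr_eq0 eq_sym node_neq0.
have lam2N0 i : lam2 i != 0 by rewrite pnatr_eq0.
pose f z : R[i] := (symbol s z)%:C.
have f0l y : f (0, y) = 0 by rewrite /f (symbol_eq0l _ _ (m := 0))//; exact: node_neq0.
have f0r y : f (y, 0) = 0 by rewrite /f (symbol_eq0r _ _ (m := 0))//; exact: node_neq0.
exists f, (diag_op dot g lam1), (diag_op dot g lam2), (diag_op dot h lam1).
pose m1 : 'I_N -> R := fun=> -1.
have diffE : ((diag_op dot g lam1 : H -> H) \- diag_op dot g lam2)%R = diag_op dot g m1.
  apply/funext => x /=; rewrite diag_opB; apply: eq_diag_op => i.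
  by rewrite /lam1 /lam2 -natr1 opprD addrA subrr add0r.
have diff1 : (opnorm (diag_op dot g m1) <= 1)%E.
  apply: opnorm_le => x x1; apply: le_trans x1.
  rewrite -(ler_pXn2r (_ : (0 < 2)%N)) ?nnegrE//.
  rewrite (norm_sum_family dot_norm og); apply: le_trans (bessel dot_norm og x).
  by apply: ler_sum => i _; rewrite rmorphN1 mulN1r normrN.
split.
- exact: band_limited_symbol.
- exact: Linfty_norm_symbol_le.
- by split; exact: diag_op_selfadjoint.
- rewrite diffE; split => // p p0.
  apply: schatten_norm_rank_le => //; first exact: continuous_diag_op.
  exact: rank_le_diag_op.
(* The constant unit vector, on which a matrix with equal entries attains its norm. Its image has
   coefficients N r^2 = 1 along every g_i, hence norm sqrt N. *)
pose x0 := \sum_k r%:C *: h k.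
have x01 : `|x0| <= 1.
  rewrite (@norm_sum_family_real _ _ (fun=> r))// sumr_const card_ord -mulr_natl r2N.
  by rewrite sqrtr1.
apply: le_trans (opnorm_ge _ x01); rewrite lee_fin /=.
rewrite !fun_calc_diag_op// [X in _ - X]big1 ?subr0; last first.
  move=> i _; apply: big1 => k _; rewrite /f (symbol_eq0l _ _ (m := (node i).+1)).
    by rewrite mul0r scale0r.
  by move=> j; exact: node_neqS.
rewrite (_ : \sum_i _ = \sum_i 1%:C *: g i).
  rewrite (@norm_sum_family_real _ _ (fun=> 1))//=.
  by rewrite expr1n sumr_const card_ord.
apply: eq_bigr => i _; rewrite -scaler_suml; congr (_ *: _).
(* The sign occurs once in the symbol and once in <h_k, g_i>, so it cancels and all terms equal
   r^2. *)
rewrite (eq_bigr (fun=> (r ^+ 2)%:C)).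
  by rewrite sumr_const card_ord -mulr_natl -(rmorph_nat (real_complex R)) -rmorphM/= r2N.
move=> k _; rewrite /f symbol_node dot_sum_family// hg -!rmorphM/=; congr (_%:C).
by rewrite -[RHS]mulr1 -(s2 i k); ring.
Qed.

End Counterexample.

(** It suffices that 2^n exceeds |C|^(1/d). *)
Lemma powR_pow2_unbounded {R : realType} (d C : R) : 0 < d ->
  exists n : nat, C < (2 ^ n)%:R `^ d.
Proof.
move=> d0; exists (Num.bound (`|C| `^ d^-1)).
have := upper_nthrootP (leqnn (Num.bound (`|C| `^ d^-1))).
move=> /(gt0_ltr_powR d0); rewrite !nnegrE powR_ge0 -natrX ler0n => /(_ isT isT).
rewrite -powRrM mulVf ?gt_eqF// powRr1//.
exact: le_lt_trans (ler_norm C).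
Qed.


Theorem theorem8p1 (R : realType) (H : completeNormedModType R[i])
    (dot : {dot H for Num.conj})
    (dot_norm : forall x : H, dot x x = `|x| ^+ 2)
    (H_infinite : infinite_dimensional H) :
  (~ exists M : R, 0 < M /\
     forall (f : R * R -> R[i]) (A1 A2 B : {linear H -> H}),
       band_limited f ->
       finite_rank_selfadjoint dot A1 ->
       finite_rank_selfadjoint dot A2 ->
       finite_rank_selfadjoint dot B ->
       (opnorm (fun_calc dot f A1 B \- fun_calc dot f A2 B)%R
          <= M%:E * Linfty_norm f * opnorm ((A1 : H -> H) \- A2)%R)%E)
  /\
  (forall p : R, 2 < p ->
   ~ exists M : R, 0 < M /\
     forall (f : R * R -> R[i]) (A1 A2 B : {linear H -> H}),
       band_limited f ->
       finite_rank_selfadjoint dot A1 ->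
       finite_rank_selfadjoint dot A2 ->
       finite_rank_selfadjoint dot B ->
       (schatten_norm p (fun_calc dot f A1 B \- fun_calc dot f A2 B)%R
          <= M%:E * Linfty_norm f * schatten_norm p ((A1 : H -> H) \- A2)%R)%E).
Proof.
split=> [[M [M0 bound]]|p p2 [M [M0 bound]]].
- have half0 : 0 < 2^-1 :> R by rewrite invr_gt0.
  (* The bound would give sqrt N <= 4 M for every N = 2^n. *)
  have [n] := powR_pow2_unbounded (M * 4) half0.
  rewrite powR12_sqrt//; apply/negP; rewrite -leNgt -lee_fin.
  have [f [A1 [A2 [B [bf /andP[f0 f4] [sA1 sA2 sB] [A12 _] le_diff]]]]] :=
    unbounded_double_operator_difference dot_norm n H_infinite.
  apply: (le_trans le_diff); apply: (le_trans (bound f A1 A2 B bf sA1 sA2 sB)).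
  rewrite -[leRHS]mule1 EFinM; apply: lee_pmul => //.
  + by rewrite mule_ge0// lee_fin ltW.
  + exact: opnorm_ge0.
  + by rewrite lee_pmul2l.
- have p0 : 0 < p by rewrite (lt_trans _ p2).
  (* Here p > 2 enters: the bound would give sqrt N <= 4 M N^(1/p), and the exponent of the quotient
     is positive. *)
  have d0 : 0 < 2^-1 - p^-1 by rewrite subr_gt0 ltf_pV2// posrE.
  have [n] := powR_pow2_unbounded (M * 4) d0.
  have N0 : (2 ^ n)%:R != 0 :> R by rewrite pnatr_eq0 -lt0n expn_gt0.
  apply/negP; rewrite -leNgt powRD ?N0 ?implybT// powRN powR12_sqrt//.
  rewrite ler_pdivrMr ?powR_gt0 ?ltr0n ?expn_gt0// -lee_fin.
  have [f [A1 [A2 [B [bf /andP[f0 f4] [sA1 sA2 sB] [_ /(_ p p0) A12] le_diff]]]]] :=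
    unbounded_double_operator_difference dot_norm n H_infinite.
  apply: (le_trans le_diff); apply: (le_trans (opnorm_le_schatten_norm _ p0)).
  apply: (le_trans (bound f A1 A2 B bf sA1 sA2 sB)).
  rewrite !EFinM; apply: lee_pmul => //.
  + by rewrite mule_ge0// lee_fin ltW.
  + exact: poweR_ge0.
  + by rewrite lee_pmul2l.
Qed.
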